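(* There exists a two-generated, recursively presented, bi-orderable solvable group of derived length $3$ with undecidable word problem.
   Context: A group is bi-orderable if it has a linear order invariant under both left and right multiplication. A finitely generated group $G=\langle X\rangle$ ($X$ finite) is recursively presented if $\{u\in (X\cup X^{-1})^*\mid u=_G1\}$ is recursively enumerable (equivalently, it has a presentation $\langle X\mid R\rangle$ with $R$ recursively enumerable), and has decidable word problem if this set is recursive; here $(X\cup X^{-1})^*$ is the set of finite words in the letters $x^{\pm1}$, $x\in X$. These properties do not depend on the choice of finite generating set. *)

(* Defs.v *)
From HB Require Import structures.
From mathcomp Require Import all_boot.

Set Implicit Arguments.
Unset Strict Implicit.
Unset Printing Implicit Defensive.

Local Open Scope nat_scope.

(* Kleene's mu-recursive functions.  Programs carry no arity: a program is run
   on a list of arguments, and [computes f v y] has no derivation when f cannot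
   be applied to as many arguments as v has. *)
Inductive recfun : Type :=
| Zero
| Succ
| Proj of nat
| Comp of recfun & seq recfun
| PrimRec of recfun & recfun
| Mu of recfun.

Inductive computes : recfun -> seq nat -> nat -> Prop :=
| computes_zero : computes Zero [::] 0
| computes_succ k : computes Succ [:: k] k.+1
| computes_proj i v : i < size v -> computes (Proj i) v (nth 0 v i)
| computes_comp f gs v ys y :
    size ys = size gs ->
    (forall i, i < size gs -> computes (nth Zero gs i) v (nth 0 ys i)) ->
    computes f ys y ->
    computes (Comp f gs) v y
| computes_primrec0 f g v y :
    computes f v y -> computes (PrimRec f g) (0 :: v) y
| computes_primrecS f g k v r y :
    computes (PrimRec f g) (k :: v) r ->
    computes g [:: k, r & v] y ->
    computes (PrimRec f g) (k.+1 :: v) y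
(* Every value below the least zero y must be defined and nonzero;
   h lists their predecessors. *)
| computes_mu f v y (h : nat -> nat) :
    (forall k, k < y -> computes f (k :: v) (h k).+1) ->
    computes f (y :: v) 0 ->
    computes (Mu f) v y.

(* The letter (i, b) stands for x_i, or for its inverse when b is true. *)
Definition word (n : nat) : Type := seq ('I_n * bool).

(* Bijective numeration in base 2n: for n > 0 this is a bijection from words
   onto the natural numbers. *)
Definition word_code (n : nat) (w : word n) : nat :=
  foldr (fun (l : 'I_n * bool) c => 2 * n * c + (2 * l.1 + l.2).+1) 0 w.

Definition recursively_enumerable (n : nat) (L : word n -> Prop) : Prop :=
  exists f, forall w, L w <-> exists y, computes f [:: word_code w] y.

Definition recursive (n : nat) (L : word n -> Prop) : Prop :=
  exists f, forall w,
    (L w /\ computes f [:: word_code w] 1) \/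
    (~ L w /\ computes f [:: word_code w] 0).

Local Open Scope group_scope.

Inductive generated (G : groupType) (S : G -> Prop) : G -> Prop :=
| generated_in g : S g -> generated S g
| generated_1 : generated S 1
| generated_mul g h : generated S g -> generated S h -> generated S (g * h)
| generated_inv g : generated S g -> generated S g^-1.

Definition generating (G : groupType) (n : nat) (x : 'I_n -> G) : Prop :=
  forall g, generated (fun h => exists i, h = x i) g.

Definition word_val (G : groupType) (n : nat) (x : 'I_n -> G) (w : word n) : G :=
  \prod_(l <- w) (if l.2 then (x l.1)^-1 else x l.1).

Definition recursively_presented (G : groupType) (n : nat) (x : 'I_n -> G) : Prop :=
  recursively_enumerable (fun w => word_val x w = 1).

Definition decidable_word_problem (G : groupType) (n : nat) (x : 'I_n -> G) : Prop :=
  recursive (fun w => word_val x w = 1).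

Definition bi_orderable (G : groupType) : Prop :=
  exists le : rel G,
    [/\ reflexive le, antisymmetric le, transitive le & total le] /\
    (forall g h k : G, le h k -> le (g * h) (g * k) /\ le (h * g) (k * g)).

Fixpoint derived (G : groupType) (k : nat) : G -> Prop :=
  if k is j.+1 then
    generated (fun g => exists a b, [/\ derived j a, derived j b & g = [~ a, b]])
  else fun _ => True.

Definition derived_trivial (G : groupType) (k : nat) : Prop :=
  forall g : G, derived k g -> g = 1.

Definition solvable_of_derived_length (G : groupType) (d : nat) : Prop :=
  derived_trivial G d /\ forall k, derived_trivial G k -> d <= k.

(* Main.v *)
From HB Require Import structures.
Require Import Defs.
From mathcomp Require Import all_boot all_order all_algebra.
From mathcomp Require Import finmap monalg boolp zify ring.

(** Let K be a recursively enumerable set of natural numbers that is not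
    recursive. P. Hall's group is generated by elements b_i, indexed by the
    integers, and t, where t b_i t^-1 = b_(i+1) and the commutators
    [b_i, b_j] are central and depend only on j - i; the elements
    z_k = [b_0, b_k], k > 0, are then a basis of a free abelian central
    subgroup. The group wanted is the quotient in which z_(n+1) = 1 for all n
    in K. It is generated by b_0 and t.

    Concretely it consists of triples (v, z, m): v is a finitely supported
    integer function on the integers (the exponents of the b_i), z lies in the
    free abelian group on the complement of K, m is the exponent of t, and the
    group law is twisted by a shift-invariant bilinear form ([corr]).

    Commutators have m = 0 and commutators of those have v = 0, so the third
    derived subgroup is trivial; the second is not, because of the commutator of
    b_1 b_0^-1 and b_(k+1) b_k^-1 ([derived2_nontrivial]). The lexicographic
    order on triples, with the free abelian parts ordered by their leading
    coefficients, is bi-invariant: conjugation shifts v and fixes central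
    elements ([hall_bi_orderable]).

    The value of a word is a triple of explicit finite sums ([hall_prod]), so
    the word is trivial when finitely many integers vanish, except that a
    central coordinate may be nonzero if its index lies in K ([word_val_eq1]).
    This is a recursively enumerable condition. Conversely [b_0, b_(n+1)] is
    trivial if and only if n belongs to K, so the word problem is undecidable.

    For K one takes the programs that return 0 on their own code, as run by an
    abstract machine whose transition function is computable
    ([computable1_step]). Diagonalization ([halting_undecidable]) rests on
    the machine carrying out every terminating computation
    ([reaches_return]). *)

Set Implicit Arguments.
Unset Strict Implicit.
Unset Printing Implicit Defensive.

Import Order.TTheory GRing.Theory Num.Theory.
Local Open Scope nat_scope.

(** * Computable functions *)

(** Arguments as nested pairs rather than lists: functions of k arguments are
    then functions of the variables e.1, e.2.1, e.2.2.1, and so on, and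
    computability can be proved by recursion on the shape of their bodies. *)
Fixpoint env (k : nat) : Type := if k is j.+1 then (nat * env j)%type else unit.

Fixpoint args (k : nat) : env k -> seq nat :=
  if k is j.+1 return env k -> seq nat then fun e => e.1 :: args e.2
  else fun=> [::].

Lemma size_args k (e : env k) : size (args e) = k.
Proof. by elim: k e => //= k IH [a e] /=; rewrite IH. Qed.

Definition computable k (F : env k -> nat) : Prop :=
  exists f, forall e, computes f (args e) (F e).

Definition env_computable k j (S : env k -> env j) : Prop :=
  exists gs, size gs = j /\ forall e i, i < j ->
    computes (nth Zero gs i) (args e) (nth 0 (args (S e)) i).

(** A change of arguments is itself a list of programs, so [Comp] composes a
    program with it; all closure properties below reduce to this one and to
    primitive recursion. *)
Lemma computable_subst k j (F : env j -> nat) (S : env k -> env j) :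
  computable F -> env_computable S -> computable (fun e => F (S e)).
Proof.
move=> [f Hf] [gs [sgs Hgs]]; exists (Comp f gs) => e.
apply: (@computes_comp _ _ _ (args (S e))); rewrite ?size_args ?sgs //.
by move=> i Hi; apply: Hgs.
Qed.

Lemma computable_var k i :
  i < k -> computable (fun e : env k => nth 0 (args e) i).
Proof.
by move=> Hi; exists (Proj i) => e; apply: computes_proj; rewrite size_args.
Qed.

Lemma env_computable_nil k : env_computable (fun _ : env k => tt : env 0).
Proof. by exists [::]. Qed.

Lemma env_computable_cons k j (a : env k -> nat) (S : env k -> env j) :
  computable a -> env_computable S ->
  env_computable (fun e => (a e, S e) : env j.+1).
Proof.
move=> [f Hf] [gs [sgs Hgs]]; exists (f :: gs); split; first by rewrite /= sgs.
by move=> e [|i] Hi //=; apply: Hgs.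
Qed.

Lemma env_computable_id k : env_computable (fun e : env k => e).
Proof.
exists (map Proj (iota 0 k)); split; first by rewrite size_map size_iota.
move=> e i Hi; rewrite (nth_map 0) ?size_iota // nth_iota // add0n.
by apply: computes_proj; rewrite size_args.
Qed.

Lemma env_computable_behead k : env_computable (fun e : env k.+1 => e.2).
Proof.
exists (map Proj (iota 1 k)); split; first by rewrite size_map size_iota.
move=> e i Hi; rewrite (nth_map 0) ?size_iota // nth_iota // add1n.
by apply: (@computes_proj i.+1 (args e)); rewrite size_args.
Qed.

Lemma env_computable_behead2 k : env_computable (fun e : env k.+2 => e.2.2).
Proof.
exists (map Proj (iota 2 k)); split; first by rewrite size_map size_iota.
move=> e i Hi; rewrite (nth_map 0) ?size_iota // nth_iota // add2n.
by apply: (@computes_proj i.+2 (args e)); rewrite size_args.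
Qed.

Lemma computable_ext k (F G : env k -> nat) :
  (forall e, F e = G e) -> computable F -> computable G.
Proof. by move=> FG [f Hf]; exists f => e; rewrite -FG. Qed.

Definition computable1 (F : nat -> nat) := computable (fun e : env 1 => F e.1).
Definition computable2 (F : nat -> nat -> nat) :=
  computable (fun e : env 2 => F e.1 e.2.1).
Definition computable3 (F : nat -> nat -> nat -> nat) :=
  computable (fun e : env 3 => F e.1 e.2.1 e.2.2.1).

Lemma computable_app1 F k (a : env k -> nat) :
  computable1 F -> computable a -> computable (fun e => F (a e)).
Proof.
move=> HF Ha; apply: (@computable_subst k 1 _ (fun e => (a e, tt)) HF).
by apply: env_computable_cons => //; apply: env_computable_nil.
Qed.

Lemma computable_app2 F k (a b : env k -> nat) :
  computable2 F -> computable a -> computable b ->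
  computable (fun e => F (a e) (b e)).
Proof.
move=> HF Ha Hb.
apply: (@computable_subst k 2 _ (fun e => (a e, (b e, tt))) HF).
by do 2!apply: env_computable_cons => //; apply: env_computable_nil.
Qed.

Lemma computable_app3 F k (a b c : env k -> nat) :
  computable3 F -> computable a -> computable b -> computable c ->
  computable (fun e => F (a e) (b e) (c e)).
Proof.
move=> HF Ha Hb Hc.
apply: (@computable_subst k 3 _ (fun e => (a e, (b e, (c e, tt)))) HF).
by do 3!apply: env_computable_cons => //; apply: env_computable_nil.
Qed.

Lemma computable_let k (F : nat -> env k -> nat) (n : env k -> nat) :
  computable (fun e : env k.+1 => F e.1 e.2) -> computable n ->
  computable (fun e => F (n e) e).
Proof.
move=> HF Hn; apply: (@computable_subst k k.+1 _ (fun e => (n e, e)) HF).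
by apply: env_computable_cons => //; apply: env_computable_id.
Qed.

(** The recursion is given by its equations, so that iteration, bounded sums and
    predecessor all fall under it. *)
Lemma computable_primrec k (H : nat -> env k -> nat) (A : env k -> nat)
    (G : nat -> nat -> env k -> nat) :
  (forall e, H 0 e = A e) -> (forall n e, H n.+1 e = G n (H n e) e) ->
  computable A -> computable (fun e : env k.+2 => G e.1 e.2.1 e.2.2) ->
  computable (fun e : env k.+1 => H e.1 e.2).
Proof.
move=> H0 HS [f Hf] [g Hg]; exists (PrimRec f g) => -[n e] /=.
elim: n => [|n IH]; first by apply: computes_primrec0; rewrite H0.
by apply: computes_primrecS IH _; rewrite HS; apply: (Hg (n, (H n e, e))).
Qed.

Lemma computable_0 k : computable (fun _ : env k => 0).
Proof.
exists (Comp Zero [::]) => e.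
by apply: (@computes_comp _ _ _ [::]) => //; apply: computes_zero.
Qed.

Lemma computable_succ k (a : env k -> nat) :
  computable a -> computable (fun e => (a e).+1).
Proof.
apply: (@computable_app1 succn k a).
by exists Succ => -[n []]; apply: computes_succ.
Qed.

Lemma computable_const k n : computable (fun _ : env k => n).
Proof. by elim: n => [|n]; [apply: computable_0 | apply: computable_succ]. Qed.

Ltac computable_var :=
  match goal with |- @computable ?k _ =>
    first [ exact: (@computable_var k 0 isT) | exact: (@computable_var k 1 isT)
          | exact: (@computable_var k 2 isT) | exact: (@computable_var k 3 isT)
          | exact: (@computable_var k 4 isT) | exact: (@computable_var k 5 isT) ]
  end.

Lemma computable_iter k (F : env k -> nat -> nat) (n a : env k -> nat) :
  computable (fun e : env k.+1 => F e.2 e.1) -> computable n -> computable a ->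
  computable (fun e => iter (n e) (F e) (a e)).
Proof.
move=> HF Hn Ha.
apply: (@computable_let k (fun m e => iter m (F e) (a e)) n) => //.
apply: (@computable_primrec k (fun m e => iter m (F e) (a e)) a
  (fun _ r e => F e r)) => //.
apply: (@computable_subst _ k.+1 _ (fun e : env k.+2 => e.2) HF).
exact: env_computable_behead.
Qed.

Lemma computable2_add : computable2 addn.
Proof.
apply: (@computable_ext 2 (fun e => iter e.1 succn e.2.1)).
  by move=> e; elim: e.1 => //= n ->.
by apply: (@computable_iter 2 (fun _ x => x.+1)); first apply: computable_succ;
  computable_var.
Qed.

Lemma computable_sum k (F : nat -> env k -> nat) (n : env k -> nat) :
  computable (fun e : env k.+1 => F e.1 e.2) -> computable n ->
  computable (fun e => \sum_(0 <= i < n e) F i e).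
Proof.
move=> HF Hn.
apply: (@computable_let k (fun m e => \sum_(0 <= i < m) F i e) n) => //.
apply: (@computable_primrec k (fun m e => \sum_(0 <= i < m) F i e) (fun=> 0)
  (fun i r e => r + F i e)).
- by move=> e; rewrite big_geq.
- by move=> m e; rewrite big_nat_recr.
- exact: computable_0.
apply: (computable_app2 computable2_add); first by computable_var.
apply: (@computable_subst _ k.+1 _ (fun e : env k.+2 => (e.1, e.2.2)) HF).
apply: env_computable_cons; first by computable_var.
exact: env_computable_behead2.
Qed.

Lemma computable2_mul : computable2 muln.
Proof.
apply: (@computable_ext 2 (fun e => \sum_(0 <= i < e.1) e.2.1)).
  by move=> e; rewrite sum_nat_const_nat subn0.
by apply: (@computable_sum 2 (fun _ e => e.2.1)); computable_var.
Qed.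

Lemma computable1_pred : computable1 predn.
Proof.
by apply: (@computable_primrec 0 (fun n _ => n.-1) (fun=> 0) (fun n _ _ => n));
  [by [] | by [] | apply: computable_0 | computable_var].
Qed.

Lemma computable2_sub : computable2 subn.
Proof.
apply: (@computable_ext 2 (fun e => iter e.2.1 predn e.1)).
  by move=> e; elim: e.2.1 => [|n /= ->]; rewrite ?subn0 ?subnS.
apply: (@computable_iter 2 (fun _ x => x.-1)); try computable_var.
by apply: (computable_app1 computable1_pred); computable_var.
Qed.

Lemma computable2_leq : computable2 (fun m n => m <= n).
Proof.
apply: (@computable_ext 2 (fun e => 1 - (e.1 - e.2.1))) => [e|].
  by case: leqP; lia.
apply: (computable_app2 computable2_sub); first exact: computable_const.
by apply: (computable_app2 computable2_sub); computable_var.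
Qed.

Lemma computable2_and : computable2 (fun m n => (m != 0) && (n != 0)).
Proof.
apply: (@computable_ext 2 (fun e => 1 <= e.1 * e.2.1)) => [e|].
  by case: e.1 e.2.1 => [|?] [|?]; rewrite ?muln0.
apply: (computable_app2 computable2_leq); first exact: computable_const.
by apply: (computable_app2 computable2_mul); computable_var.
Qed.

Lemma computable_and k (p q : env k -> bool) :
  computable (fun e => p e) -> computable (fun e => q e) ->
  computable (fun e => p e && q e).
Proof.
move=> Hp Hq.
apply: computable_ext (computable_app2 computable2_and Hp Hq) => e.
by rewrite /=; case: (p e); case: (q e).
Qed.

Lemma computable_neg k (p : env k -> bool) :
  computable (fun e => p e) -> computable (fun e => ~~ p e).
Proof.
move=> Hp; apply: (@computable_ext _ (fun e => 1 - p e)) => [e|].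
  by case: (p e).
by apply: (computable_app2 computable2_sub) => //; apply: computable_const.
Qed.

Lemma computable_or k (p q : env k -> bool) :
  computable (fun e => p e) -> computable (fun e => q e) ->
  computable (fun e => p e || q e).
Proof.
move=> Hp Hq.
apply: (@computable_ext _ (fun e => ~~ (~~ p e && ~~ q e))) => [e|].
  by rewrite negb_and !negbK.
by apply/computable_neg/computable_and; apply: computable_neg.
Qed.

Lemma computable2_eq : computable2 (fun m n => m == n).
Proof.
apply: (@computable_ext 2 (fun e => (e.1 <= e.2.1) && (e.2.1 <= e.1))) => [e|].
  by rewrite -eqn_leq.
by apply: computable_and; apply: (computable_app2 computable2_leq);
  computable_var.
Qed.

(** Both branches are total, so the choice can be made by arithmetic. *)
Lemma computable_if k (p : env k -> bool) (a b : env k -> nat) :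
  computable (fun e => p e) -> computable a -> computable b ->
  computable (fun e => if p e then a e else b e).
Proof.
move=> Hp Ha Hb.
apply: (@computable_ext _ (fun e => p e * a e + ~~ p e * b e)) => [e|].
  by case: (p e); rewrite ?mul1n ?mul0n ?addn0.
apply: (computable_app2 computable2_add);
  apply: (computable_app2 computable2_mul) => //.
exact: computable_neg.
Qed.

Lemma computable_all k (p : nat -> env k -> bool) (n : env k -> nat) :
  computable (fun e : env k.+1 => p e.1 e.2) -> computable n ->
  computable (fun e => all (fun i => p i e) (iota 0 (n e))).
Proof.
move=> Hp Hn.
apply: (@computable_ext _ (fun e => \sum_(0 <= i < n e) ~~ p i e == 0)) => [e|].
  congr nat_of_bool; rewrite /index_iota subn0.
  elim: (iota _ _) => [|i s IH] /=; first by rewrite big_nil.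
  by rewrite big_cons addn_eq0 IH eqb0 negbK.
apply: (computable_app2 computable2_eq); last exact: computable_0.
by apply: computable_sum => //; apply: computable_neg.
Qed.

(** Each step peels off the head symbol of the function, the defined constants
    being looked up in the hint database. The heads are matched syntactically:
    unification up to unfolding would take arithmetic operations and
    comparisons for one another. *)
Ltac computable_step :=
  lazymatch goal with
  | |- computable (fun _ => ?n) => exact: computable_const
  | |- computable (fun e => (@?a e).+1) => apply: (@computable_succ _ a)
  | |- computable (fun e => (@?a e).-1) =>
      apply: (@computable_app1 predn _ a computable1_pred)
  | |- computable (fun e => @?a e + @?b e) =>
      apply: (@computable_app2 addn _ a b computable2_add)
  | |- computable (fun e => @?a e * @?b e) =>
      apply: (@computable_app2 muln _ a b computable2_mul)
  | |- computable (fun e => @?a e - @?b e) =>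
      apply: (@computable_app2 subn _ a b computable2_sub)
  | |- computable (fun e => nat_of_bool (@?a e <= @?b e)) =>
      apply: (@computable_app2 (fun m n => m <= n) _ a b computable2_leq)
  | |- computable (fun e => nat_of_bool (@?a e == @?b e)) =>
      apply: (@computable_app2 (fun m n => m == n) _ a b computable2_eq)
  | |- computable (fun e => nat_of_bool (@?p e && @?q e)) =>
      apply: (@computable_and _ p q)
  | |- computable (fun e => nat_of_bool (@?p e || @?q e)) =>
      apply: (@computable_or _ p q)
  | |- computable (fun e => nat_of_bool (~~ @?p e)) =>
      apply: (@computable_neg _ p)
  | |- computable (fun e => nat_of_bool (all (@?p e) (@?n e))) =>
      apply: computable_all
  | |- computable (fun e => bigop (@?x e) (@?n e) (@?F e)) =>
      apply: computable_sum
  | |- computable (fun e => iter (@?n e) (@?F e) (@?a e)) =>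
      apply: (@computable_iter _ F n a)
  | |- _ =>
      first
        [ match goal with
          | |- computable (fun e => ?F (@?a e)) => is_const F;
              apply: (@computable_app1 F _ a);
                [solve [eauto with computable nocore] | ]
          | |- computable (fun e => ?F (@?a e) (@?b e)) => is_const F;
              apply: (@computable_app2 F _ a b);
                [solve [eauto with computable nocore] | |]
          | |- computable (fun e => ?F (@?a e) (@?b e) (@?c e)) => is_const F;
              apply: (@computable_app3 F _ a b c);
                [solve [eauto with computable nocore] | | |]
          | |- computable (fun e => nat_of_bool (?F (@?a e) (@?b e))) => is_const F;
              apply: (@computable_app2 (fun m n => nat_of_bool (F m n)) _ a b);
                [solve [eauto with computable nocore] | |]
          end
        | computable_var
        | apply: computable_if ]
  end; cbv beta.
Create HintDb computable.
Ltac computable_tac := cbv beta; repeat computable_step.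

(** * A machine for recursive functions, and its halting problem *)

(** A variant of the Cantor pairing: (a + b)^2 + a determines a + b because it
    lies below (a + b + 1)^2. The successor leaves 0 free to code the empty
    list. *)
Definition npair (a b : nat) : nat := ((a + b) * (a + b) + a).+1.

Lemma npair_inj a b c d : npair a b = npair c d -> a = c /\ b = d.
Proof.
rewrite /npair => -[E].
have S : a + b = c + d.
  by case: (ltngtP (a + b) (c + d)) => // H; nia.
by move: E; rewrite S => /addnI E; split=> //; move: S; rewrite E => /addnI.
Qed.

(** The projections are written as searches bounded by the pair itself, which
    makes them computable without inverting the pairing by square roots. *)
Definition pfst (p : nat) : nat :=
  \sum_(0 <= a < p) \sum_(0 <= b < p) (npair a b == p) * a.
Definition psnd (p : nat) : nat :=
  \sum_(0 <= a < p) \sum_(0 <= b < p) (npair a b == p) * b.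

Lemma unpair_sum (F : nat -> nat -> nat) a b :
  \sum_(0 <= i < npair a b) \sum_(0 <= j < npair a b)
    (npair i j == npair a b) * F i j = F a b.
Proof.
have Ha : a < npair a b by rewrite /npair; nia.
have Hb : b < npair a b by rewrite /npair; nia.
have zero i j : (i, j) != (a, b) -> (npair i j == npair a b) * F i j = 0.
  by case: (npair i j =P npair a b) => // /npair_inj[-> ->]; rewrite eqxx.
rewrite (bigD1_seq a) ?mem_index_iota ?iota_uniq //= [X in _ + X]big1 => [|i Hi].
  rewrite (bigD1_seq b) ?mem_index_iota ?iota_uniq //= eqxx mul1n.
  rewrite big1 ?addn0 // => j Hj; apply: zero.
  by rewrite xpair_eqE negb_and Hj orbT.
by apply: big1 => j _; apply: zero; rewrite xpair_eqE negb_and Hi.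
Qed.

Lemma pfst_pair a b : pfst (npair a b) = a.
Proof. exact: (unpair_sum (fun i _ => i)). Qed.

Lemma psnd_pair a b : psnd (npair a b) = b.
Proof. exact: (unpair_sum (fun _ j => j)). Qed.

Lemma computable2_npair : computable2 npair.
Proof. by rewrite /computable2 /npair; computable_tac. Qed.
#[local] Hint Resolve computable2_npair : computable.

Lemma computable1_pfst : computable1 pfst.
Proof. by rewrite /computable1 /pfst; computable_tac. Qed.

Lemma computable1_psnd : computable1 psnd.
Proof. by rewrite /computable1 /psnd; computable_tac. Qed.
#[local] Hint Resolve computable1_pfst computable1_psnd : computable.

(** The arguments of a composition are stored in reverse: they are evaluated
    from the last to the first, which leaves their values in the right order. *)
Fixpoint prog (f : recfun) : nat :=
  match f with
  | Zero => npair 0 0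
  | Succ => npair 1 0
  | Proj i => npair 2 i
  | Comp f gs =>
      npair 3 (npair (prog f) (foldl (fun l g => npair (prog g) l) 0 gs))
  | PrimRec f g => npair 4 (npair (prog f) (prog g))
  | Mu f => npair 5 (prog f)
  end.

Definition code_list : seq nat -> nat := foldr npair 0.

(** An abstract machine for recursive functions. A state either evaluates the
    program c on the arguments v, or returns the value y, in front of a
    stack k of frames that say what to do with the value. *)
Definition eval_st (c v k : nat) : nat := npair 0 (npair c (npair v k)).
Definition ret_st (y k : nat) : nat := npair 1 (npair y k).
Definition comp_frame (f gs v acc : nat) : nat :=
  npair 0 (npair f (npair gs (npair v acc))).
Definition primrec_frame (g i v : nat) : nat :=
  npair 1 (npair g (npair i v)).
Definition mu_frame (f v i : nat) : nat :=
  npair 2 (npair f (npair v i)).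

(** Evaluating a composition: gs are the programs still to be run, acc the
    values found so far. *)
Definition comp_step (f gs v acc k : nat) : nat :=
  if gs == 0 then eval_st f acc k
  else eval_st (pfst gs) v (npair (comp_frame f (psnd gs) v acc) k).

Definition step_eval (c v k : nat) : nat :=
  if pfst c == 0 then ret_st 0 k else
  if pfst c == 1 then ret_st (pfst v).+1 k else
  if pfst c == 2 then
    if psnd c == 0 then ret_st (pfst v) k
    else eval_st (npair 2 (psnd c).-1) (psnd v) k else
  if pfst c == 3 then comp_step (pfst (psnd c)) (psnd (psnd c)) v 0 k else
  if pfst c == 4 then
    if pfst v == 0 then eval_st (pfst (psnd c)) (psnd v) k
    else eval_st c (npair (pfst v).-1 (psnd v))
           (npair (primrec_frame (psnd (psnd c)) (pfst v).-1 (psnd v)) k)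
  else eval_st (psnd c) (npair 0 v) (npair (mu_frame (psnd c) v 0) k).

Definition resume_comp (y x k : nat) : nat :=
  comp_step (pfst x) (pfst (psnd x)) (pfst (psnd (psnd x)))
    (npair y (psnd (psnd (psnd x)))) k.

Definition resume_primrec (y x k : nat) : nat :=
  eval_st (pfst x) (npair (pfst (psnd x)) (npair y (psnd (psnd x)))) k.

Definition resume_mu (y x k : nat) : nat :=
  let f := pfst x in let v := pfst (psnd x) in let i := psnd (psnd x) in
  if y == 0 then ret_st i k
  else eval_st f (npair i.+1 v) (npair (mu_frame f v i.+1) k).

Definition resume (y fr k : nat) : nat :=
  if pfst fr == 0 then resume_comp y (psnd fr) k else
  if pfst fr == 1 then resume_primrec y (psnd fr) k
  else resume_mu y (psnd fr) k.

Definition step (s : nat) : nat :=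
  if pfst s == 0 then
    step_eval (pfst (psnd s)) (pfst (psnd (psnd s))) (psnd (psnd (psnd s)))
  else
    if psnd (psnd s) == 0 then s
    else resume (pfst (psnd s)) (pfst (psnd (psnd s))) (psnd (psnd (psnd s))).

Lemma computable1_step : computable1 step.
Proof.
have step_eval_comp : computable3 step_eval.
  rewrite /computable3 /step_eval /comp_step /eval_st /ret_st /primrec_frame
    /comp_frame /mu_frame.
  by computable_tac.
have resume_computable : computable3 resume.
  rewrite /computable3 /resume /resume_comp /resume_primrec /resume_mu /comp_step
    /eval_st /ret_st /primrec_frame /comp_frame /mu_frame.
  by computable_tac.
by rewrite /computable1 /step; computable_tac.
Qed.

#[local] Hint Resolve computable1_step : computable.

Definition pairK := (pfst_pair, psnd_pair).

Definition reaches (s t : nat) : Prop := exists n, iter n step s = t.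

Lemma reaches_refl s : reaches s s.
Proof. by exists 0. Qed.

Lemma reaches_trans t s u : reaches s t -> reaches t u -> reaches s u.
Proof. by move=> [m <-] [n <-]; exists (n + m); rewrite iterD. Qed.

Lemma reaches_step s t u : step s = t -> reaches t u -> reaches s u.
Proof. by move=> <-; apply: reaches_trans; exists 1. Qed.

Lemma step_evalE c v k : step (eval_st c v k) = step_eval c v k.
Proof. by rewrite /step /eval_st !pairK. Qed.

Lemma step_retE y fr k : step (ret_st y (npair fr k)) = resume y fr k.
Proof. by rewrite /step /ret_st !pairK. Qed.

(** The machine follows derivations: one that ends in the value y is run in
    finitely many steps, whatever the rest of the stack. As the machine is
    deterministic, this settles its outcome on every program that has a
    value. *)
Lemma reaches_return f v y :
  computes f v y ->
  forall k, reaches (eval_st (prog f) (code_list v) k) (ret_st y k).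
Proof.
elim=> {f v y}.
- move=> k; apply: reaches_step (reaches_refl _).
  by rewrite step_evalE /step_eval /= !pairK.
- move=> n k; apply: reaches_step (reaches_refl _).
  by rewrite step_evalE /step_eval /= !pairK.
- move=> i v; elim: v i => [|a v IH] [|i] //= Hi k.
    by apply: reaches_step (reaches_refl _); rewrite step_evalE /step_eval !pairK.
  by apply: reaches_step (IH i Hi k); rewrite step_evalE /step_eval !pairK.
- move=> f gs v ys y sz _ IHgs _ IHf k.
  (* The last size gs - m arguments are done and m are left. *)
  have loop m : m <= size gs ->
    reaches
      (comp_step (prog f) (foldl (fun l g => npair (prog g) l) 0 (take m gs))
         (code_list v) (code_list (drop m ys)) k) (ret_st y k).
    elim: m => [|m IHm] Hm.
      by rewrite take0 drop0 /comp_step /=; apply: IHf.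
    rewrite (take_nth Zero Hm) foldl_rcons /comp_step /= !pairK.
    apply: reaches_trans (IHgs m Hm _) _.
    apply: reaches_step (IHm (ltnW Hm)).
    rewrite step_retE /resume /resume_comp !pairK.
    by rewrite [in RHS](@drop_nth _ 0 m) ?sz.
  apply: reaches_step (loop (size gs) (leqnn _)).
  by rewrite step_evalE /step_eval /= !pairK take_size drop_oversize ?sz.
- move=> f g v y _ IH k; apply: reaches_step (IH k).
  by rewrite step_evalE /step_eval /= !pairK.
- move=> f g i v r y _ IHr _ IHg k.
  have := IHr (npair (primrec_frame (prog g) i (code_list v)) k) => /= IHr'.
  rewrite /= in IHr'; apply: reaches_step (reaches_trans IHr' _).
    by rewrite step_evalE /step_eval /= !pairK.
  apply: reaches_step (IHg k).
  by rewrite step_retE /resume /resume_primrec /= !pairK.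
- move=> f v y h _ IHpos _ IH0 k.
  (* Backwards from the zero y, since the search stops there. *)
  have loop j : j <= y -> reaches
      (eval_st (prog f) (npair (y - j) (code_list v))
         (npair (mu_frame (prog f) (code_list v) (y - j)) k)) (ret_st y k).
    elim: j => [|j IHj] Hj.
      rewrite subn0; apply: reaches_trans (IH0 _) (reaches_step _ (reaches_refl _)).
      by rewrite step_retE /resume /resume_mu !pairK.
    have lt : y - j.+1 < y by lia.
    apply: reaches_trans (IHpos _ lt _) (reaches_step _ (IHj (ltnW Hj))).
    rewrite step_retE /resume /resume_mu !pairK /=.
    by rewrite (_ : (y - j.+1).+1 = y - j) //; lia.
  apply: reaches_step (loop y (leqnn _)).
  by rewrite step_evalE /step_eval /= !pairK subnn.
Qed.

Lemma step_final y : step (ret_st y 0) = ret_st y 0.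
Proof. by rewrite /step /ret_st !pairK. Qed.

Lemma iter_step_final n y : iter n step (ret_st y 0) = ret_st y 0.
Proof. by elim: n => //= n ->; apply: step_final. Qed.

Lemma reaches_final_inj s y z :
  reaches s (ret_st y 0) -> reaches s (ret_st z 0) -> y = z.
Proof.
move=> [m Hm] [n Hn].
suff /npair_inj[_ /npair_inj[]] : ret_st y 0 = ret_st z 0 by [].
rewrite -(iter_step_final n y) -(iter_step_final m z) -Hm -Hn.
by rewrite -!iterD addnC.
Qed.

(** Two values of one program would be two final states of one run. *)
Lemma computes_inj f v y z : computes f v y -> computes f v z -> y = z.
Proof.
move=> /reaches_return/(_ 0) Hy /reaches_return/(_ 0) Hz.
exact: reaches_final_inj Hy Hz.
Qed.

(** Halting within s steps, with value 0, of the program n on its own code. *)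
Definition halts (n s : nat) : bool :=
  iter s step (eval_st n (npair n 0) 0) == ret_st 0 0.

Lemma computable2_halts : computable2 (fun n s => halts n s).
Proof.
rewrite /computable2 /halts /eval_st /ret_st.
by computable_tac.
Qed.

#[local] Hint Resolve computable2_halts : computable.

Lemma halts_leq n s t : s <= t -> halts n s -> halts n t.
Proof.
move=> /subnK <-; rewrite /halts iterD => /eqP ->.
by rewrite iter_step_final.
Qed.

Definition decidable_set (P : nat -> Prop) : Prop :=
  exists f, forall n,
    (P n /\ computes f [:: n] 1) \/ (~ P n /\ computes f [:: n] 0).

(** Diagonalization: run on its own code, a decision procedure returns 0 exactly
    when it claims that this run does not return 0. *)
Lemma halting_undecidable : ~ decidable_set (fun n => exists s, halts n s).
Proof.
move=> [f /(_ (prog f))[] [Hn Hf]]; move/reaches_return/(_ 0): Hf => /= Hf.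
- have [s /eqP Hs] := Hn.
  by have := reaches_final_inj Hf (ex_intro _ s Hs).
- by case: Hn; case: Hf => s Hs; exists s; apply/eqP.
Qed.

(** * Orders on free abelian groups and on groups *)

Local Open Scope ring_scope.

Section FreeAbelian.
Variable K : choiceType.
Implicit Types (g : {malg int[K]}).

(** The additive extension of a function given on the basis. *)
Definition linext (A : zmodType) (h : K -> A) g : A :=
  \sum_(k <- msupp g) h k *~ g@_k.

Lemma linextEw (A : zmodType) (h : K -> A) g (D : {fset K}) :
  (msupp g `<=` D)%fset -> linext h g = \sum_(k <- D) h k *~ g@_k.
Proof.
move=> gD; apply: (big_fset_incl +%R) => // k _ /mcoeff_outdom ->.
exact: mulr0z.
Qed.

Lemma linext_is_zmod_morphism (A : zmodType) (h : K -> A) :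
  zmod_morphism (linext h).
Proof.
move=> f g; pose D := (msupp f `|` msupp g)%fset.
rewrite (@linextEw _ _ (f - g) D) ?msuppB_le //.
rewrite (@linextEw _ _ f D) ?fsubsetUl // (@linextEw _ _ g D) ?fsubsetUr //.
by rewrite -sumrB; apply: eq_bigr => k _; rewrite mcoeffB mulrzBr.
Qed.

HB.instance Definition _ (A : zmodType) (h : K -> A) :=
  GRing.isZmodMorphism.Build {malg int[K]} A (linext h)
    (linext_is_zmod_morphism h).

Lemma linextU (A : zmodType) (h : K -> A) k : linext h << k >> = h k.
Proof.
by rewrite (linextEw h (msuppU_le (k := k))) big_seq_fset1 mcoeffUU.
Qed.

Lemma linext_sub (A : zmodType) (h h' : K -> A) g :
  linext (fun k => h k - h' k) g = linext h g - linext h' g.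
Proof. by rewrite -sumrB; apply: eq_bigr => k _; rewrite mulrzBl. Qed.

Lemma eq_linext (A : zmodType) (h h' : K -> A) g :
  h =1 h' -> linext h g = linext h' g.
Proof. by move=> eqh; apply: eq_bigr => k _; rewrite eqh. Qed.

Lemma malg_ind (P : {malg int[K]} -> Prop) :
  P 0 -> (forall f g, P f -> P g -> P (f + g)) -> (forall f, P f -> P (- f)) ->
  (forall k, P << k >>) -> forall g, P g.
Proof.
move=> P0 PD PN PU g; rewrite [g]monalgE.
have Pn k n : P << n%:Z *g k >>.
  elim: n => [|n IH]; first by rewrite monalgU0.
  by rewrite intS monalgUD; apply: PD.
apply: big_ind => // k _; case: (g@_k) => n //.
by rewrite NegzE monalgUN; apply: PN.
Qed.

(** Identities between additive maps of finitely supported functions are checked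
    on the basis; this gives all properties of shifts and correlations. *)
Lemma malg_morphism_ext (A : zmodType) (f f' : {additive {malg int[K]} -> A}) :
  (forall k, f << k >> = f' << k >>) -> f =1 f'.
Proof.
move=> H; apply: malg_ind => [|g g' E E'|g E|//]; first by rewrite !raddf0.
  by rewrite !raddfD E E'.
by rewrite !raddfN E.
Qed.

End FreeAbelian.

(** * Hall's group *)

(** When E vanishes on nonpositive integers, the triple (v, z, m) stands for
    z times the product of the powers of the b_i with exponents v, in decreasing
    order of i, times t^m. *)
Definition hall (A : zmodType) (E : int -> A) : Type :=
  ({malg int[int]} * A * int)%type.

(** Ordering the basis by an injection r into a totally ordered set orders the
    free abelian group: an element is positive when its coefficient of highest
    index is. *)
Section LeadingCoefficient.
Variables (K : choiceType) (d : Order.disp_t) (T : orderType d) (r : K -> T).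
Hypothesis r_inj : injective r.
Implicit Types g h : {malg int[K]}.

Definition lead_pos g : Prop :=
  exists k, 0 < g@_k /\ forall j, (r k < r j)%O -> g@_j = 0.

Lemma lead_pos0 : ~ lead_pos 0.
Proof. by case=> k []; rewrite mcoeff0. Qed.

Lemma lead_posD g h : lead_pos g -> lead_pos h -> lead_pos (g + h).
Proof.
move=> [k [gk gz]] [l [hl hz]].
case: (ltgtP (r k) (r l)) => [kl|lk|/r_inj kl].
- exists l; rewrite mcoeffD gz // add0r; split=> // j lj.
  by rewrite mcoeffD hz // gz ?addr0 // (lt_trans kl).
- exists k; rewrite mcoeffD (hz k) // addr0; split=> // j kj.
  by rewrite mcoeffD gz // hz ?addr0 // (lt_trans lk).
- exists k; rewrite mcoeffD addr_gt0 ?kl // -?kl //; split=> // j kj.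
  by rewrite mcoeffD gz // hz ?addr0 // -kl.
Qed.

Lemma lead_pos_total g : [\/ g = 0, lead_pos g | lead_pos (- g)].
Proof.
have top (s : seq K) :
    s = [::] \/ exists2 k, k \in s & forall j, j \in s -> (r j <= r k)%O.
  elim: s => [|k s [->|[l ls lmax]]]; [by left| |]; right.
    by exists k; rewrite ?inE // => j; rewrite inE => /eqP ->.
  case: (leP (r l) (r k)) => [lk|/ltW kl].
    exists k; rewrite ?mem_head // => j; rewrite inE => /orP[/eqP-> //|/lmax jl].
    exact: le_trans lk.
  exists l; rewrite ?inE ?ls ?orbT // => j /orP[/eqP-> //|]; exact: lmax.
case: (top (msupp g)) => [g0|[k ks kmax]].
  by constructor 1; rewrite [g]monalgE g0 big_nil.
have gz j : (r k < r j)%O -> g@_j = 0.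
  move=> kj; apply: mcoeff_outdom; apply/negP => /kmax.
  by rewrite leNgt kj.
move: ks; rewrite -mcoeff_neq0 neq_lt => /orP[gk|gk].
  constructor 3; exists k; rewrite mcoeffN oppr_gt0; split=> // j /gz.
  by rewrite mcoeffN => ->; rewrite oppr0.
by constructor 2; exists k.
Qed.
End LeadingCoefficient.

Section PositiveCone.
Local Open Scope group_scope.

(** Bi-orders correspond to normal positive cones, by comparing g and h through
    g^-1 * h. *)
Lemma positive_cone_bi_orderable (G : groupType) (P : G -> Prop) :
  ~ P 1 -> (forall g h, P g -> P h -> P (g * h)) ->
  (forall g h, P g -> P (g ^ h)) -> (forall g, [\/ g = 1, P g | P g^-1]) ->
  bi_orderable G.
Proof.
move=> P1 PM PJ Ptot; exists (fun g h => `[< g = h \/ P (g^-1 * h) >]); split.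
  split.
  - by move=> g; apply/asboolP; left.
  - move=> g h /andP[/asboolP[//|Pgh] /asboolP[//|Phg]].
    by have := PM _ _ Pgh Phg; rewrite mulgA mulgK mulVg.
  - move=> h g k /asboolP[->//|Pgh] /asboolP[<-|Phk]; apply/asboolP; right=> //.
    by have := PM _ _ Pgh Phk; rewrite mulgA mulgK.
  - move=> g h; apply/orP; case: (Ptot (g^-1 * h)) => [E|Pgh|Phg].
    + by left; apply/asboolP; left; rewrite -[RHS](mulVKg g) E mulg1.
    + by left; apply/asboolP; right.
    + by right; apply/asboolP; right; move: Phg; rewrite invgM invgK.
move=> g h k /asboolP[->|Phk]; first by split; apply/asboolP; left.
split; apply/asboolP; right.
  by rewrite invgM mulgA mulgVK.
by have := PJ _ g Phk; rewrite /conjg invgM !mulgA.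
Qed.
End PositiveCone.

Section HallGroup.
Variables (A : zmodType) (E : int -> A).
Local Notation V := {malg int[int]}.

Definition shift (m : int) : V -> V := linext (fun i => << (i + m)%R >>).
HB.instance Definition _ m := GRing.Additive.on (shift m).

Lemma shiftU m i : shift m << i >> = << (i + m)%R >>.
Proof. exact: linextU. Qed.

Lemma shiftD m n v : shift (m + n) v = shift m (shift n v).
Proof.
apply: (malg_morphism_ext (f := shift (m + n)) (f' := shift m \o shift n)) => i.
by rewrite /= !shiftU -addrA [n + m]addrC.
Qed.

Lemma shift0 v : shift 0 v = v.
Proof.
apply: (malg_morphism_ext (f := shift 0) (f' := idfun)) => i.
by rewrite /= shiftU addr0.
Qed.

Lemma shift_add m v w : shift m (v + w) = shift m v + shift m w.
Proof. exact: raddfD. Qed.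

Lemma shift_opp m v : shift m (- v) = - shift m v.
Proof. exact: raddfN. Qed.

Lemma shift_zero m : shift m 0 = 0.
Proof. exact: raddf0. Qed.

Lemma mcoeff_shift m v i : (shift m v)@_i = v@_(i - m)%R.
Proof.
apply: (malg_morphism_ext (f := mcoeff i \o shift m)
                          (f' := mcoeff (i - m)%R)) => j.
by rewrite /= shiftU !mcoeffU [j == _]eq_sym subr_eq [i == _]eq_sym.
Qed.

(** The weighted cross-correlation of v and w, with weight E k for the lag k.
    It is the 2-cocycle of the group law: moving b_j to the left of b_i, for
    i < j, produces the central element E (j - i). *)
Definition corr (v w : V) : A :=
  linext (fun i => linext (fun j => E (j - i)) w) v.

Definition corr_r (w v : V) : A := corr v w.

Lemma corr_is_zmod_morphism v : zmod_morphism (corr v).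
Proof.
move=> w w'; rewrite /corr -linext_sub; apply: eq_linext => i.
exact: raddfB.
Qed.
HB.instance Definition _ v :=
  GRing.isZmodMorphism.Build V A (corr v) (corr_is_zmod_morphism v).

Lemma corr_r_is_zmod_morphism w : zmod_morphism (corr_r w).
Proof. by move=> v v'; rewrite /corr_r /corr raddfB. Qed.
HB.instance Definition _ w :=
  GRing.isZmodMorphism.Build V A (corr_r w) (corr_r_is_zmod_morphism w).

Lemma corrDl v v' w : corr (v + v') w = corr v w + corr v' w.
Proof. exact: (raddfD (corr_r w)). Qed.

Lemma corrNl v w : corr (- v) w = - corr v w.
Proof. exact: (raddfN (corr_r w)). Qed.

Lemma corr0l w : corr 0 w = 0.
Proof. exact: (raddf0 (corr_r w)). Qed.

Lemma corrDr v w w' : corr v (w + w') = corr v w + corr v w'.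
Proof. exact: raddfD. Qed.

Lemma corrNr v w : corr v (- w) = - corr v w.
Proof. exact: raddfN. Qed.

Lemma corr0r v : corr v 0 = 0.
Proof. exact: raddf0. Qed.

Lemma corrUU i j : corr << i >> << j >> = E (j - i).
Proof. by rewrite /corr !linextU. Qed.

(** Only lags matter, so t acts on the central extension; this is what makes the
    group law associative. *)
Lemma corr_shift m v w : corr (shift m v) (shift m w) = corr v w.
Proof.
apply: (malg_morphism_ext (f := corr_r (shift m w) \o shift m)
                          (f' := corr_r w)) => i.
rewrite /= /corr_r shiftU.
apply: (malg_morphism_ext (f := corr << (i + m)%R >> \o shift m)
                          (f' := corr << i >>)) => j.
by rewrite /= shiftU !corrUU opprD addrACA subrr addr0.
Qed.

Local Notation hall := (hall E).
HB.instance Definition _ := Choice.copy hall (V * A * int)%type.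

Definition hall_one : hall := (0, 0, 0).
Definition hall_mul (g h : hall) : hall :=
  let: (v, z, m) := g in let: (v', z', m') := h in
  (v + shift m v', z + z' + corr v (shift m v'), m + m').
Definition hall_inv (g : hall) : hall :=
  let: (v, z, m) := g in (- shift (- m) v, corr v v - z, - m).

Lemma hall_mulA : associative hall_mul.
Proof.
move=> [[v z] m] [[v' z'] m'] [[v'' z''] m''] /=.
rewrite shift_add -shiftD !addrA; congr (_, _, _).
rewrite corrDr corrDl shiftD corr_shift.
move: (corr v' _) (corr v (shift m v')) (corr v _) => a b c.
by rewrite addrA [RHS]addrA [RHS](ACl (1*2*4*6*3*5))%AC.
Qed.

Lemma hall_mul1g : left_id hall_one hall_mul.
Proof. by move=> [[v z] m] /=; rewrite shift0 corr0l !(add0r, addr0). Qed.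

Lemma hall_mulg1 : right_id hall_one hall_mul.
Proof. by move=> [[v z] m] /=; rewrite shift_zero corr0r !addr0. Qed.

Lemma hall_mulVg : left_inverse hall_one hall_inv hall_mul.
Proof.
by move=> [[v z] m] /=; rewrite corrNl corr_shift !addNr subrK subrr.
Qed.

Lemma hall_mulgV : right_inverse hall_one hall_inv hall_mul.
Proof.
move=> [[v z] m] /=; rewrite shift_opp -shiftD !subrr shift0 corrNr subrr.
by rewrite [z + _]addrC subrK subrr.
Qed.

HB.instance Definition _ := isGroup.Build hall
  hall_mulA hall_mul1g hall_mulg1 hall_mulVg hall_mulgV.

Lemma hall_mulE v z m v' z' m' :
  (((v, z, m) : hall) * ((v', z', m') : hall))%g
  = (v + shift m v', z + z' + corr v (shift m v'), m + m') :> hall.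
Proof. by []. Qed.

Lemma hall_invE v z m :
  ((v, z, m) : hall)^-1%g = (- shift (- m) v, corr v v - z, - m) :> hall.
Proof. by []. Qed.
End HallGroup.

Section HallProperties.
Variables (A : zmodType) (E : int -> A).
Local Notation V := {malg int[int]}.
Local Notation H := (hall E).

(** Conjugation moves v by a shift, and alters z by the commutator form of the
    cocycle, which vanishes when v = 0. *)
Lemma hall_conjE v z w y n :
  (((v, z, 0) : H) ^ ((w, y, n) : H))%g
  = (shift (- n) v, z + corr E v w - corr E w v, 0) :> H.
Proof.
rewrite /conjg hall_invE !hall_mulE shift0 shift_add corrNl corrDr !corr_shift.
rewrite addrCA addNr addr0 add0r addNr; congr (_, _, _).
move: (corr E w w) (corr E v w) (corr E w v) => a b c.
apply: (addIr (c + a)); rewrite subrK [RHS]addrA subrK.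
rewrite [z + y]addrC -[y + z + b]addrA.
by rewrite [LHS]addrA subrK addrC.
Qed.

Lemma hall_commE v z w y :
  [~ ((v, z, 0) : H), ((w, y, 0) : H)]%g
  = (0, corr E v w - corr E w v, 0) :> H.
Proof.
rewrite commgEl hall_conjE hall_invE hall_mulE !oppr0 !shift0 addNr addr0 corrNl.
congr (_, _, _); move: (corr E v v) (corr E v w) (corr E w v) => x p q.
by rewrite -[z + p - q]addrA [_ + (z + _)]addrA subrK addrAC subrr add0r.
Qed.

Lemma hall_comm_shiftE v z n :
  [~ ((v, z, 0) : H), ((0, 0, n) : H)]%g
  = (shift (- n) v - v, corr E v v - corr E v (shift (- n) v), 0) :> H.
Proof.
rewrite commgEl hall_conjE hall_invE hall_mulE !oppr0 !shift0 !addr0.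
rewrite corrNl corr0l corr0r.
by rewrite addr0 subr0 subrK addrC.
Qed.

Definition texp (g : H) : int := g.2.

Lemma texp_comm (g h : H) : texp [~ g, h]%g = 0.
Proof.
move: g h => [[v z] m] [[w y] n].
by rewrite /texp /commg /conjg !hall_invE !hall_mulE /=; ring.
Qed.

Lemma derived1_texp (g : H) : derived 1 g -> texp g = 0.
Proof.
elim=> {g} [g [a [b [_ _ ->]]]||[[v z] m] [[w y] n] _ + _|[[v z] m] _].
- exact: texp_comm.
- by [].
- by rewrite /texp /= => -> ->.
- by rewrite /texp /= => ->.
Qed.

Lemma derived2_central (g : H) : derived 2 g -> exists z, g = (0, z, 0).
Proof.
elim=> {g} [g [[[v z] m] [[[w y] n] [Da Db ->]]]||g h _ [y ->] _ [z ->]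
           |g _ [z ->]].
- move: (derived1_texp Da) (derived1_texp Db); rewrite /texp /= => -> ->.
  by rewrite hall_commE; eexists.
- by exists 0.
- by rewrite hall_mulE shift0 !addr0; eexists.
- by rewrite hall_invE shift0 oppr0; eexists.
Qed.

Lemma derived3_trivial : derived_trivial H 3.
Proof.
move=> g; elim=> {g} [g [a [b [Da Db ->]]]|//|g h _ -> _ ->|g _ ->].
- have [z ->] := derived2_central Da; have [y ->] := derived2_central Db.
  by rewrite hall_commE corr0l subrr.
- by rewrite mulg1.
- by rewrite invg1.
Qed.

(** The commutators of t with b_0 and with b_k are, up to central factors,
    b_1 b_0^-1 and b_(k+1) b_k^-1, and their commutator is minus the
    second difference at k of the function E i - E (- i). *)
Lemma derived2_nontrivial k :
  let w := E k - E (k - 1) - (E (k + 1) - E k) in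
  let w' := E (- k) - E (- k - 1) - (E (1 - k) - E (- k)) in
  derived_trivial H 2 -> w = w'.
Proof.
move=> w w' /(_ (0, w - w', 0)) triv; apply/eqP; rewrite -subr_eq0; apply/eqP.
suff /triv : derived 2 ((0, w - w', 0) : H) by case.
pose d i : V := << (i + 1)%R >> - << i >>.
have D i : exists z, derived 1 ((d i, z, 0) : H).
  eexists; apply: generated_in.
  exists (<< i >>, 0, 0), (0, 0, -1); split=> //.
  by rewrite hall_comm_shiftE opprK shiftU.
have [y Dy] := D 0; have [z Dz] := D k.
apply: generated_in; exists (d 0, y, 0), (d k, z, 0); split=> //.
rewrite hall_commE; congr (_, _, _).
rewrite /d !(corrDl, corrDr, corrNl, corrNr, corrUU).
have -> : k + 1 - (0 + 1) = k by lia.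
have -> : k - (0 + 1) = k - 1 by lia.
have -> : 0 + 1 - (k + 1) = - k by lia.
have -> : 0 - (k + 1) = - k - 1 by lia.
have -> : 0 + 1 - k = 1 - k by lia.
by rewrite !subr0 sub0r /w /w' !opprD.
Qed.

(** The lexicographic cone of the series with quotients Z, V and A. *)
Definition hall_pos (P : A -> Prop) (PV : V -> Prop) (g : H) : Prop :=
  0 < texp g \/ texp g = 0 /\ (PV g.1.1 \/ g.1.1 = 0 /\ P g.1.2).

(** The cone is normal because conjugation keeps m, only shifts v when m = 0,
    and fixes the central elements. *)
Lemma hall_bi_orderable (P : A -> Prop) :
  ~ P 0 -> (forall y z, P y -> P z -> P (y + z)) ->
  (forall z, [\/ z = 0, P z | P (- z)]) -> bi_orderable H.
Proof.
move=> P0 PD Ptot.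
pose PV : V -> Prop := lead_pos (id : int -> int).
have PVD := @lead_posD _ _ _ (id : int -> int) (fun _ _ => id).
have PV0 := @lead_pos0 int _ _ (id : int -> int).
apply: (@positive_cone_bi_orderable _ (hall_pos P PV)).
- by case=> [|[_ [/PV0|[]]]] //; rewrite /texp ltxx.
- move=> [[v z] m] [[w y] n]; rewrite hall_mulE /hall_pos /texp /=.
  case=> [m0|[-> Pg]] [n0|[-> Ph]]; rewrite ?addr0 ?add0r; try by left.
    by left; apply: addr_gt0.
  right; split=> //; rewrite shift0.
  case: Pg Ph => [Pv|[-> Pz]] [Pw|[-> Py]]; rewrite ?addr0 ?add0r; try by left.
    by left; apply: PVD.
  by right; rewrite corr0l addr0; split=> //; apply: PD.
- move=> [[v z] m] [[w y] n] [m0|[/= m0 Pg]].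
    left; move: m0; rewrite /conjg hall_invE !hall_mulE /texp /=.
    by rewrite (_ : - n + (m + n) = m) //; lia.
  rewrite /texp /= in m0; rewrite m0 hall_conjE; right; split=> //=.
  case: Pg => [[i [vi vz]]|[-> Pz]]; [left|right].
    exists (i - n); split=> [|j /= ij]; rewrite mcoeff_shift opprK.
      by rewrite subrK.
    by apply: vz; rewrite /= -ltrBlDr.
  by rewrite shift_zero corr0l corr0r addr0 subr0.
- move=> [[v z] m]; rewrite hall_invE /hall_pos /texp /=.
  case: (ltgtP m 0) => [m0|m0|->].
  - by constructor 3; left; rewrite oppr_gt0.
  - by constructor 2; left.
  rewrite oppr0 shift0.
  case: (@lead_pos_total _ _ _ (id : int -> int) v) => [->|Pv|Pv]; last 2 first.
  - by constructor 2; right; split=> //; left.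
  - by constructor 3; right; split=> //; left.
  rewrite corr0l sub0r oppr0.
  case: (Ptot z) => [->|Pz|Pz]; first by constructor 1.
  - by constructor 2; right; split=> //; right.
  - by constructor 3; right; split=> //; right.
Qed.

Definition hall_b : H := (<< 0%R >>, 0, 0).
Definition hall_t : H := (0, 0, 1).

Local Open Scope group_scope.

Lemma hall_gen_t (S : H -> Prop) n : S hall_t -> generated S ((0, 0, n) : H).
Proof.
move=> St; have nat_case m : generated S ((0, 0, m%:Z) : H).
  elim: m => [|m IH]; first exact: generated_1.
  have := generated_mul (generated_in St) IH.
  by rewrite hall_mulE shift_zero corr0r !addr0 -intS.
case: n => m //; have := generated_inv (nat_case m.+1).
by rewrite hall_invE shift_zero oppr0 corr0l subr0 NegzE.
Qed.

Lemma hall_gen_b (S : H -> Prop) i :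
  S hall_b -> S hall_t -> generated S ((<< i >>, 0, 0)%R : H).
Proof.
move=> Sb St.
have := generated_mul (generated_mul (hall_gen_t i St) (generated_in Sb))
                      (hall_gen_t (- i)%R St).
rewrite /hall_b !hall_mulE shiftU shift_zero corr0l corr0r.
by rewrite !addr0 !add0r subrr.
Qed.

(** The conjugates of b by powers of t are the b_i, whose commutators
    [b_0, b_k] = E k - E (- k) have to span A. *)
Lemma hall_generated (S : H -> Prop) :
  S hall_b -> S hall_t ->
  (forall Q : A -> Prop, Q 0%R -> (forall y z, Q y -> Q z -> Q (y + z)%R) ->
     (forall z, Q z -> Q (- z)%R) -> (forall k, Q (E k - E (- k))%R) ->
     forall z, Q z) ->
  forall g, generated S g.
Proof.
move=> Sb St genA.
have genZ : forall z, generated S ((0, z, 0)%R : H).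
  apply: genA => [|y z gy gz|z gz|k].
  - exact: generated_1.
  - by have := generated_mul gy gz; rewrite hall_mulE shift_zero corr0r !addr0.
  - have := generated_inv gz.
    by rewrite hall_invE shift_zero oppr0 corr0l sub0r.
  have gb i := @hall_gen_b S i Sb St.
  have := generated_mul
    (generated_mul (generated_inv (gb 0%R)) (generated_inv (gb k)))
    (generated_mul (gb 0%R) (gb k)).
  have <- : [~ ((<< 0 >>, 0, 0) : H), ((<< k >>, 0, 0) : H)]
            = (0, (E k - E (- k)), 0)%R.
    by rewrite hall_commE !corrUU subr0 sub0r.
  by rewrite /commg /conjg !mulgA.
have genV : forall v : V, exists z, generated S ((v, z, 0)%R : H).
  apply: malg_ind => [|v w [z gz] [y gy]|v [z gz]|i].
  - by exists 0%R; apply: generated_1.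
  - eexists; have := generated_mul gz gy; rewrite hall_mulE shift0 addr0; exact.
  - eexists; have := generated_inv gz; rewrite hall_invE oppr0 shift0; exact.
  - by exists 0%R; apply: hall_gen_b.
move=> [[v z] m]; have [y gy] := genV v.
have := generated_mul (generated_mul gy (genZ (z - y)%R)) (hall_gen_t m St).
by rewrite !hall_mulE !shift_zero !corr0r !addr0 add0r [(y + _)%R]addrC subrK.
Qed.

End HallProperties.

Section HallQuotient.
Variable p : pred nat.

Local Notation C := {n : nat | ~~ p n}.

(** Lag n + 1 has its own central basis element, unless p n, when b_0 and
    b_(n+1) commute. With weight 0 on nonpositive lags, E k itself is the
    commutator [b_0, b_k]. *)
Definition central_gen (k : int) : {malg int[C]} :=
  if k is Posz n.+1 then
    if insub n is Some c then << (c : C) >> else 0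
  else 0.

Local Notation H := (hall central_gen).

Lemma mcoeff_central_gen k c : (central_gen k)@_c = (k == (val c).+1%:Z)%:R.
Proof.
case: k => [[|n]|n] /=; rewrite ?mcoeff0 //.
case: insubP => [d _ <-|pn]; first by rewrite mcoeffU -val_eqE eqz_nat eqSS.
rewrite mcoeff0; case: eqP => // -[nE].
by move: (valP c) pn; rewrite nE => /negPf ->.
Qed.

Lemma central_gen_eq0 n : central_gen n.+1 = 0 <-> p n.
Proof.
split=> [E0|pn]; last by rewrite /central_gen insubN // pn.
apply/negPn/negP => pn.
have := mcoeff_central_gen n.+1 (Sub n pn); rewrite E0 mcoeff0 SubK eqxx.
by [].
Qed.

Definition gens (i : 'I_2) : H := if i == 0 :> nat then hall_b _ else hall_t _.

Lemma gens_generating : generating gens.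
Proof.
apply: hall_generated; first by exists ord0.
  by exists (inord 1); rewrite /gens inordK.
move=> Q Q0 QD QN QE; apply: malg_ind => // c.
suff -> : << c >> = central_gen (val c).+1 - central_gen (- ((val c).+1%:Z)).
  by [].
apply/malgP => d; rewrite mcoeffB !mcoeff_central_gen mcoeffU.
rewrite [X in _ - X](_ : _ = 0); last by case: eqP => //; lia.
by rewrite subr0 eqz_nat eqSS -val_eqE.
Qed.

Lemma gens_bi_orderable : bi_orderable H.
Proof.
apply: (@hall_bi_orderable _ _ (lead_pos (val : C -> nat))).
- exact: lead_pos0.
- exact: lead_posD val_inj.
- by move=> z; apply: lead_pos_total; apply: val_inj.
Qed.

(** If n does not satisfy p then that second difference, taken at n + 1, has
    coefficient 2 up to sign at the basis element of n. *)
Lemma gens_derived_length :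
  (exists n, ~~ p n) -> solvable_of_derived_length H 3.
Proof.
move=> [n pn]; split; first exact: derived3_trivial.
have nontriv : ~ derived_trivial H 2.
  move=> /(@derived2_nontrivial _ _ n.+1%:Z) /(congr1 (mcoeff (Sub n pn))).
  rewrite !(mcoeffB, mcoeff_central_gen) SubK.
  by do !case: eqP => //=; lia.
have mono k : derived_trivial H k -> derived_trivial H k.+1.
  move=> triv g; elim=> {g} [g [a [b [/triv-> /triv-> ->]]]||g h _ -> _ ->|g _ ->].
  - exact: commgg.
  - by [].
  - by rewrite mulg1.
  - by rewrite invg1.
move=> k triv; rewrite leqNgt; apply/negP; case: k triv => [|[|[|//]]] triv _;
  apply: nontriv => //; do ?exact: mono; exact/mono/mono.
Qed.

End HallQuotient.

(** * Reading off the value of a word *)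

Section Products.
Variables (A : zmodType) (E : int -> A) (eps tau : nat -> int).
Local Notation H := (hall E).

(** The exponent of t accumulated before the letter j. *)
Definition height (j : nat) : int := \sum_(0 <= i < j) tau i.

(** Moving all powers of t to the right turns the letter b at place j into
    b_i with i the height at j; the cocycle then collects one term for each pair
    of b-letters. *)
Lemma hall_prod n :
  (\prod_(0 <= j < n) ((<< 0%R >> *~ eps j, 0, tau j)%R : H))%g
  = (\sum_(0 <= j < n) << height j >> *~ eps j,
     \sum_(0 <= j < n) \sum_(0 <= i < j)
       E (height j - height i) *~ (eps i * eps j),
     height n) :> H.
Proof.
elim: n => [|n IH]; first by rewrite /height !big_geq.
rewrite big_nat_recr //= IH hall_mulE {IH}.
have shiftZ m k : shift m (<< 0%R >> *~ k) = << m >> *~ k.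
  by rewrite /shift raddfMz /= linextU add0r.
rewrite shiftZ [in RHS]big_nat_recr //= [in RHS]big_nat_recr //= addr0.
congr (_, _ + _, _); last by rewrite /height [in RHS]big_nat_recr.
rewrite raddfMz /=.
have -> : corr E (\sum_(0 <= j < n) << height j >> *~ eps j) << height n >>
          = \sum_(0 <= j < n) E (height n - height j) *~ eps j.
  rewrite -[LHS]/(corr_r E << height n >> _) raddf_sum; apply: eq_bigr => i _.
  by rewrite raddfMz /= /corr_r corrUU.
by rewrite mulrz_suml; apply: eq_bigr => i _; rewrite mulrzA.
Qed.
End Products.

(** The code of the word obtained from the word of code c by dropping its first
    j letters. The first letter left is read from the residue modulo 4,
    namely 1, 2, 3, 0 for b, b^-1, t, t^-1; code 0, the empty word, also has
    residue 0. *)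
Definition digit_rest (c j : nat) : nat := iter j (fun r => r.-1 %/ 4)%N c.
Definition is_b (c j : nat) : bool := (digit_rest c j %% 4 == 1)%N.
Definition is_bV (c j : nat) : bool := (digit_rest c j %% 4 == 2)%N.
Definition is_t (c j : nat) : bool := (digit_rest c j %% 4 == 3)%N.
Definition is_tV (c j : nat) : bool :=
  (digit_rest c j %% 4 == 0)%N && (digit_rest c j != 0)%N.

Definition b_exp (c j : nat) : int := (is_b c j)%:Z - (is_bV c j)%:Z.
Definition t_exp (c j : nat) : int := (is_t c j)%:Z - (is_tV c j)%:Z.

Lemma digit_rest0 j : digit_rest 0 j = 0%N.
Proof. by elim: j => //= j; rewrite /digit_rest /= => ->. Qed.

(** Heights and coefficients are integers; to compute with them, their positive
    and negative parts are counted separately. *)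
Definition nb_t (c j : nat) : nat := \sum_(0 <= i < j) is_t c i.
Definition nb_tV (c j : nat) : nat := \sum_(0 <= i < j) is_tV c i.

Lemma sum_subz (F G : nat -> nat) n :
  (\sum_(0 <= i < n) F i)%N%:Z - (\sum_(0 <= i < n) G i)%N%:Z
  = \sum_(0 <= i < n) ((F i)%:Z - (G i)%:Z).
Proof.
have sumz (f : nat -> nat) :
    (\sum_(0 <= i < n) f i)%N%:Z = \sum_(0 <= i < n) (f i)%:Z.
  exact: (big_morph Posz PoszD (erefl _)).
by rewrite !sumz sumrB.
Qed.

Lemma eqz_subz (m n : nat) : (m == n) = (m%:Z - n%:Z == 0 :> int).
Proof. by rewrite subr_eq0 eqz_nat. Qed.

Lemma height_t_exp c j : height (t_exp c) j = (nb_t c j)%:Z - (nb_tV c j)%:Z.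
Proof. by rewrite /nb_t /nb_tV sum_subz. Qed.

Definition abelian_part (c : nat) : {malg int[int]} :=
  \sum_(0 <= j < c) << height (t_exp c) j >> *~ b_exp c j.

Definition same_height (c l j : nat) : bool :=
  (nb_t c j + nb_tV c l == nb_t c l + nb_tV c j)%N.

Definition lag (c k i j : nat) : bool :=
  (nb_t c j + nb_tV c i == nb_t c i + nb_tV c j + k.+1)%N.

(** All coefficients of the vector vanish as soon as those at the heights of the
    letters do, the others being 0 anyway. *)
Definition abelian_test (c : nat) : bool :=
  all (fun l => \sum_(0 <= j < c) same_height c l j * is_b c j
             == \sum_(0 <= j < c) same_height c l j * is_bV c j)%N (iota 0 c).

Definition central_test (c k : nat) : bool :=
  (\sum_(0 <= j < c) \sum_(0 <= i < j)
      lag c k i j * (is_b c i * is_b c j + is_bV c i * is_bV c j)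
   == \sum_(0 <= j < c) \sum_(0 <= i < j)
      lag c k i j * (is_b c i * is_bV c j + is_bV c i * is_b c j))%N.

Lemma same_heightE c l j :
  same_height c l j = (height (t_exp c) j == height (t_exp c) l).
Proof. by rewrite /same_height !height_t_exp -eqz_nat !PoszD; lia. Qed.

Lemma lagE c k i j :
  lag c k i j = (height (t_exp c) j - height (t_exp c) i == k.+1%:Z).
Proof. by rewrite /lag !height_t_exp -eqz_nat !PoszD; lia. Qed.

(** Lags in a word are bounded by its length, which leaves finitely many central
    coordinates to inspect. *)
Lemma lag_lt c k i j : (i < j)%N -> lag c k i j -> (k < j)%N.
Proof.
have le_nb : (nb_t c j <= j)%N.
  rewrite /nb_t -[leqRHS]subn0 -[leqRHS]muln1 -sum_nat_const_nat.
  rewrite leq_sum // => l _; by case: is_t.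
move=> ij /eqP; have : (nb_tV c i <= nb_tV c j)%N.
  by rewrite /nb_tV (big_cat_nat (leq0n i) (ltnW ij)) leq_addr.
lia.
Qed.

Lemma abelian_testP c : reflect (abelian_part c = 0) (abelian_test c).
Proof.
have coef k : (abelian_part c)@_k
    = \sum_(0 <= j < c) (((height (t_exp c) j == k) * is_b c j)%N%:Z
                       - ((height (t_exp c) j == k) * is_bV c j)%N%:Z).
  rewrite raddf_sum; apply: eq_bigr => j _.
  rewrite /= raddfMz /= mcoeffU /b_exp; case: eqP => _; last by rewrite mul0rz.
  by rewrite !mul1n intz.
have testE l : (\sum_(0 <= j < c) same_height c l j * is_b c j
             == \sum_(0 <= j < c) same_height c l j * is_bV c j)%N
             = ((abelian_part c)@_(height (t_exp c) l) == 0).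
  rewrite eqz_subz sum_subz coef; congr (_ == _).
  by apply: eq_bigr => j _; rewrite same_heightE.
apply: (iffP allP) => [H|H l _]; last by rewrite testE H mcoeff0.
apply/malgP => k; rewrite mcoeff0.
have [/hasP[l lc /eqP <-]|/hasPn no_letter] :=
  boolP (has (fun l => height (t_exp c) l == k) (iota 0 c)).
  by apply/eqP; rewrite -testE; apply: H.
rewrite coef big_nat big1 // => j jc.
by rewrite (negPf (no_letter j _)) // mem_iota.
Qed.

Section WordValue.
Variable p : pred nat.
Local Notation H := (hall (central_gen p)).

(** The word is read off its code; the code is at least the length, and the
    places beyond the end contribute trivial letters. *)
Lemma word_val_code w N :
  (word_code w <= N)%N ->
  word_val (gens p) w
  = (\prod_(0 <= j < N)
      ((<< 0%R >> *~ b_exp (word_code w) j, 0, t_exp (word_code w) j)%R : H))%g.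
Proof.
have shift_letter c d j :
    (d < 4)%N -> digit_rest (4 * c + d.+1) j.+1 = digit_rest c j.
  move=> d4; rewrite /digit_rest iterSr; congr iter.
  by rewrite addnS /= mulnC divnMDl // divn_small ?addn0.
elim: w N => [|l w IH] N.
  move=> _; rewrite /word_val big_nil; apply/esym; apply: big1 => j _.
  by rewrite /b_exp /t_exp /is_b /is_bV /is_t /is_tV digit_rest0 mulr0z.
have d4 : (2 * l.1 + l.2 < 4)%N by case: l => -[[|[|//]] ?] [].
rewrite /= -[(2 * 2)%N]/4%N; case: N => [|N Nle]; first by rewrite addnS.
rewrite big_nat_recl //= /word_val big_cons -/(word_val (gens p) w).
congr (_ * _)%g; last first.
  rewrite (IH N); last by lia.
  apply: eq_bigr => j _.
  by rewrite /b_exp /t_exp /is_b /is_bV /is_t /is_tV !shift_letter.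
rewrite /b_exp /t_exp /is_b /is_bV /is_t /is_tV /digit_rest /= addnS.
have -> : ((4 * word_code w + (2 * l.1 + l.2)).+1 %% 4
           = (2 * l.1 + l.2).+1 %% 4)%N.
  by rewrite -addnS mulnC modnMDl.
rewrite /gens; case: l {d4 Nle} => -[[|[|//]] ?] [] /=.
- rewrite -[LHS]/((- shift 0 _, corr _ _ _ - 0, 0) : H).
  by rewrite shift0 corrUU subrr subr0.
- by [].
- rewrite -[LHS]/((- shift (- 1) 0, corr _ 0 _ - 0, - 1) : H).
  by rewrite shift_zero corr0l subr0 oppr0 mulr0z.
- by rewrite mulr0z.
Qed.

Definition central_part (c : nat) : {malg int[{n : nat | ~~ p n}]} :=
  \sum_(0 <= j < c) \sum_(0 <= i < j)
    central_gen p (height (t_exp c) j - height (t_exp c) i)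
      *~ (b_exp c i * b_exp c j).

Lemma central_testP c :
  central_part c = 0 <-> all (fun k => p k || central_test c k) (iota 0 c).
Proof.
have coef d : (central_part c)@_d
    = (\sum_(0 <= j < c) \sum_(0 <= i < j)
         lag c (val d) i j * (is_b c i * is_b c j + is_bV c i * is_bV c j))%N%:Z
    - (\sum_(0 <= j < c) \sum_(0 <= i < j)
         lag c (val d) i j * (is_b c i * is_bV c j + is_bV c i * is_b c j))%N%:Z.
  rewrite sum_subz raddf_sum; apply: eq_bigr => j _.
  rewrite sum_subz raddf_sum; apply: eq_bigr => i _.
  rewrite /= raddfMz /= mcoeff_central_gen lagE /b_exp.
  case: eqP => _; last by rewrite mul0rz.
  by rewrite !mul1n intz !PoszD !PoszM; ring.
split=> [z0|/allP H].
  apply/allP => k _; case: (boolP (p k)) => //= pk.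
  rewrite /central_test eqz_subz -(coef (Sub k pk)) z0 mcoeff0 //.
apply/malgP => d; rewrite mcoeff0.
case: (ltnP (val d) c) => [dc|cd].
  have := H (val d).
  rewrite mem_iota dc (negPf (valP d)) /central_test eqz_subz -coef.
  by move=> /(_ isT)/eqP.
rewrite coef sum_subz big_nat big1 // => j /= jc.
rewrite sum_subz big_nat big1 // => i /= ij.
case: (boolP (lag _ _ _ _)) => [/(lag_lt ij)|_]; last by rewrite !mul0n.
by move=> dj; move: (leq_ltn_trans cd (ltn_trans dj jc)); rewrite ltnn.
Qed.

Lemma word_val_eq1 (w : word 2) :
  let c := word_code w in
  word_val (gens p) w = 1%g <->
  [&& nb_t c c == nb_tV c c, abelian_test c
    & all (fun k => p k || central_test c k) (iota 0 c)].
Proof.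
move=> c; rewrite (@word_val_code w c) // hall_prod.
rewrite -/(abelian_part c) -/(central_part c).
split.
  case=> /abelian_testP vE /central_testP zE tE; rewrite vE zE andbT.
  by rewrite eqz_subz -height_t_exp tE.
move=> /and3P[tE /abelian_testP -> /central_testP ->].
by rewrite height_t_exp (eqP tE) subrr.
Qed.
End WordValue.

(** * The word problem *)

Local Open Scope nat_scope.

Lemma computable_divn4 : computable1 (fun c => c %/ 4).
Proof.
apply: (@computable_ext 1 (fun e => \sum_(0 <= q < e.1) (4 * q.+1 <= e.1))).
  move=> [c []] /=; transitivity (\sum_(0 <= q < c) (q < c %/ 4)).
    by apply: eq_bigr => q _; rewrite leq_divRL // mulnC.
  have count n m : \sum_(0 <= q < n) (q < m) = minn n m.
    elim: n => [|n IH]; first by rewrite big_geq // min0n.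
    by rewrite big_nat_recr //= IH; case: ltnP; lia.
  by rewrite count; apply/minn_idPr/leq_div.
by computable_tac.
Qed.

Lemma computable_modn4 : computable1 (fun c => c %% 4).
Proof.
apply: (@computable_ext 1 (fun e => e.1 - e.1 %/ 4 * 4)) => [[c []] /=|].
  by rewrite {1}(divn_eq c 4) addKn.
apply: (computable_app2 computable2_sub); first by computable_var.
apply: (computable_app2 computable2_mul); last exact: computable_const.
exact: computable_divn4.
Qed.

Lemma computable2_digit_rest : computable2 digit_rest.
Proof.
apply: (@computable_iter 2 (fun _ r => r.-1 %/ 4) (fun e => e.2.1) fst).
- apply: (computable_app1 computable_divn4).
  by apply: (computable_app1 computable1_pred); computable_var.
- by computable_var.
- by computable_var.
Qed.

Lemma computable2_digit_mod d :
  computable2 (fun c j => digit_rest c j %% 4 == d).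
Proof.
apply: (computable_app2 computable2_eq); last exact: computable_const.
exact: (computable_app1 computable_modn4 computable2_digit_rest).
Qed.

Lemma computable2_is_b : computable2 (fun c j => is_b c j).
Proof. exact: computable2_digit_mod. Qed.
Lemma computable2_is_bV : computable2 (fun c j => is_bV c j).
Proof. exact: computable2_digit_mod. Qed.
Lemma computable2_is_t : computable2 (fun c j => is_t c j).
Proof. exact: computable2_digit_mod. Qed.
Lemma computable2_is_tV : computable2 (fun c j => is_tV c j).
Proof.
apply: computable_and; first exact: computable2_digit_mod.
apply: computable_neg; apply: (computable_app2 computable2_eq).
  exact: computable2_digit_rest.
exact: computable_const.
Qed.

#[local] Hint Resolve computable2_is_b computable2_is_bV computable2_is_t
  computable2_is_tV : computable.

Lemma computable2_nb_t : computable2 nb_t.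
Proof. by rewrite /computable2 /nb_t; computable_tac. Qed.
Lemma computable2_nb_tV : computable2 nb_tV.
Proof. by rewrite /computable2 /nb_tV; computable_tac. Qed.
#[local] Hint Resolve computable2_nb_t computable2_nb_tV : computable.

Lemma computable1_abelian_test : computable1 (fun c => abelian_test c).
Proof. by rewrite /computable1 /abelian_test /same_height; computable_tac. Qed.

Lemma computable2_central_test : computable2 (fun c k => central_test c k).
Proof. by rewrite /computable2 /central_test /lag; computable_tac. Qed.
#[local] Hint Resolve computable2_central_test : computable.

(** Here s bounds the time in which the indices of the nonzero central
    coordinates are all recognized as elements of the halting set. *)
Definition trivial_by (s c : nat) : bool :=
  [&& nb_t c c == nb_tV c c, abelian_test c
    & all (fun k => halts k s || central_test c k) (iota 0 c)].

Lemma computable2_trivial_by : computable2 (fun s c => trivial_by s c).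
Proof.
rewrite /computable2 /trivial_by.
apply: computable_and; first by computable_tac.
apply: computable_and; last by computable_tac.
by apply: (computable_app1 computable1_abelian_test); computable_var.
Qed.

(** Unbounded search; programs being single-valued, it succeeds only if a
    witness exists. *)
Lemma semidecidable_ex (R : nat -> nat -> bool) :
  computable2 (fun s c => R s c) ->
  exists f, forall c, (exists s, R s c) <-> exists y, computes f [:: c] y.
Proof.
move=> /computable_neg [f Hf]; have {}Hf s c : computes f [:: s; c] (~~ R s c).
  exact: (Hf (s, (c, tt))).
exists (Mu f) => c; split=> [exR|[y Hy]].
  have [s Rs smin] := ex_minnP exR.
  exists s; apply: (@computes_mu _ _ _ (fun=> 0)) => [k ks|]; last first.
    by have := Hf s c; rewrite Rs.
  have := Hf k c; case: (boolP (R k c)) => // /smin; by rewrite leqNgt ks.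
inversion Hy as [| | | | | |g v z h _ H0]; subst.
by exists y; have := computes_inj H0 (Hf y c); case: (R y c).
Qed.

Definition halting : pred nat := fun n => `[< exists s, halts n s >].

Lemma trivial_by_word (w : word 2) :
  word_val (gens halting) w = 1%g <-> exists s, trivial_by s (word_code w).
Proof.
rewrite word_val_eq1; set c := word_code w.
split=> [/and3P[t0 ab all_c]|[s /and3P[t0 ab all_c]]]; last first.
  apply/and3P; split=> //; apply/allP => k /(allP all_c) /orP[Hk|->].
    by apply/orP; left; apply/asboolP; exists s.
  exact: orbT.
suff [s Hs] : exists s, all (fun k => halts k s || central_test c k) (iota 0 c).
  by exists s; apply/and3P.
elim: (iota 0 c) all_c => [|k l IH] /=; first by exists 0.
move=> /andP[Hk /IH[s Hs]].
have {Hk} [t Ht] : exists t, halts k t || central_test c k.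
  by case/orP: Hk => [/asboolP[t Ht]|Hk];
    [exists t; rewrite Ht | exists 0; rewrite Hk orbT].
(* Halting persists, so one time bound serves the whole list. *)
exists (s + t); apply/andP; split.
  by case/orP: Ht => [/(halts_leq (leq_addl s t)) ->|->]; rewrite ?orbT.
apply/allP => j /(allP Hs) /orP[/(halts_leq (leq_addr t s)) ->|->] //.
exact: orbT.
Qed.

Lemma gens_recursively_presented : recursively_presented (gens halting).
Proof.
have [f Hf] := semidecidable_ex computable2_trivial_by.
by exists f => w; rewrite trivial_by_word.
Qed.

Local Open Scope ring_scope.

Definition letter_b (V : bool) : 'I_2 * bool := (ord0, V).
Definition letter_t (V : bool) : 'I_2 * bool := (ord_max, V).

(** The word t^n b t^-n, with b^-1 for b when V is true, followed by w. *)
Definition conj_word (n : nat) (V : bool) (w : word 2) : word 2 :=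
  nseq n (letter_t false) ++ letter_b V :: nseq n (letter_t true) ++ w.

(** The word for the commutator of b_0 and b_n. *)
Definition comm_word (n : nat) : word 2 :=
  letter_b true :: conj_word n true (letter_b false :: conj_word n false [::]).

Section CommWord.
Variable p : pred nat.
Local Notation H := (hall (central_gen p)).

Lemma word_val_cons l (w : word 2) :
  word_val (gens p) (l :: w)
  = ((if l.2 then (gens p l.1)^-1 else gens p l.1) * word_val (gens p) w)%g.
Proof. by rewrite /word_val big_cons. Qed.

Lemma word_val_nseq n l (w : word 2) :
  word_val (gens p) (nseq n l ++ w)
  = ((if l.2 then (gens p l.1)^-1 else gens p l.1) ^+ n
     * word_val (gens p) w)%g.
Proof.
elim: n => [|n IH]; first by rewrite mul1g.
by rewrite /= word_val_cons IH expgS mulgA.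
Qed.

Lemma hall_t_exp n : (hall_t (central_gen p) ^+ n = (0, 0, n%:Z)%R :> H)%g.
Proof.
elim: n => [//|n IH].
by rewrite expgS IH hall_mulE shift_zero corr0r !addr0 -intS.
Qed.

Definition conj_b n : H :=
  (hall_b (central_gen p) ^ (hall_t (central_gen p) ^- n))%g.

Lemma conj_bE n : conj_b n = (<< n%:Z >>, 0, 0).
Proof.
rewrite /conj_b /conjg invgK hall_t_exp hall_invE /hall_b !hall_mulE shift_zero.
rewrite corr0l oppr0 shift0 !addr0 shiftU corr0r corr0l.
by rewrite subrr !add0r subrr.
Qed.

Lemma word_val_conj n V (w : word 2) :
  word_val (gens p) (conj_word n V w)
  = ((if V then (conj_b n)^-1 else conj_b n) * word_val (gens p) w)%g.
Proof.
rewrite /conj_word word_val_nseq word_val_cons word_val_nseq !mulgA expVgn.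
congr (_ * _)%g; rewrite /conj_b -conjVg /conjg invgK.
by case: V; rewrite mulgA.
Qed.

Lemma word_val_comm n :
  word_val (gens p) (comm_word n.+1) = 1%g <-> p n.
Proof.
have -> : word_val (gens p) (comm_word n.+1) = [~ hall_b _, conj_b n.+1]%g.
  rewrite /comm_word word_val_cons word_val_conj word_val_cons word_val_conj.
  by rewrite /word_val big_nil mulg1 /commg /conjg.
rewrite conj_bE hall_commE !corrUU -central_gen_eq0.
have -> : n.+1%:Z - 0 = n.+1 by rewrite subr0.
have -> : central_gen p (0 - n.+1%:Z) = 0 by [].
rewrite subr0.
by split=> [[]|->].
Qed.
End CommWord.

Local Open Scope nat_scope.

Lemma word_code_cons l (w : word 2) :
  word_code (l :: w) = 4 * word_code w + (2 * l.1 + l.2).+1.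
Proof. by []. Qed.

Lemma word_code_nseq n l (w : word 2) :
  word_code (nseq n l ++ w)
  = iter n (fun c => 4 * c + (2 * l.1 + l.2).+1) (word_code w).
Proof. by elim: n => //= n ->. Qed.

Definition conj_code (d n c : nat) : nat :=
  iter n (fun r => 4 * r + 3) (4 * iter n (fun r => 4 * r + 4) c + d).

Lemma word_code_conj n V w :
  word_code (conj_word n V w) = conj_code V.+1 n (word_code w).
Proof.
by rewrite /conj_word word_code_nseq word_code_cons word_code_nseq; case: V.
Qed.

Lemma computable1_comm_word : computable1 (fun n => word_code (comm_word n.+1)).
Proof.
apply: (@computable_ext 1
  (fun e => 4 * conj_code 2 e.1.+1 (4 * conj_code 1 e.1.+1 0 + 1) + 2)).
  move=> [n []]; rewrite /comm_word.
  by rewrite word_code_cons word_code_conj word_code_cons word_code_conj.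
by rewrite /conj_code; computable_tac.
Qed.

(** Since [b_0, b_(n+1)] is trivial exactly when program n halts, a solution of
    the word problem decides the halting set. *)
Lemma decidable_halting :
  decidable_word_problem (gens halting) ->
  decidable_set (fun n => exists s, halts n s).
Proof.
move=> [f Hf]; have [g Hg] := computable1_comm_word.
exists (Comp f [:: g]) => n.
have comp y : computes f [:: word_code (comm_word n.+1)] y ->
    computes (Comp f [:: g]) [:: n] y.
  move=> fy; apply: (computes_comp (ys := [:: word_code (comm_word n.+1)])) => //.
  by move=> [|//] _; apply: (Hg (n, tt)).
have valE :
    word_val (gens halting) (comm_word n.+1) = 1%g <-> exists s, halts n s.
  by rewrite word_val_comm; split=> /asboolP.
case: (Hf (comm_word n.+1)) => -[/valE Hn Hy]; [left|right]; split=> //;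
  exact: comp.
Qed.

Theorem theorem2 :
  exists (G : groupType) (x : 'I_2 -> G),
    [/\ generating x,
        recursively_presented x,
        bi_orderable G,
        solvable_of_derived_length G 3
      & ~ decidable_word_problem x].
Proof.
exists (hall (central_gen halting)), (gens halting); split.
- exact: gens_generating.
- exact: gens_recursively_presented.
- exact: gens_bi_orderable.
- apply: gens_derived_length; apply: contrapT => all_halt.
  apply: halting_undecidable; have [f Hf] := computable_const 1 1.
  exists f => n; left; split; last exact: (Hf (n, tt)).
  by apply: contrapT => Hn; apply: all_halt; exists n; apply/asboolP.
- by move=> /decidable_halting /halting_undecidable.
Qed.
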